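(* Let $n\ge 1$ be an integer, let $f:\mathbb{R}\to\mathbb{R}$ be a discontinuous $n$-monomial, and let $\Gamma=\overline{G(f)}^{\mathbb{R}^2}$ be the closure in $\mathbb{R}^2$ of the graph $G(f)=\{(x,f(x)):x\in\mathbb{R}\}$. For $h\in\mathbb{R}^*=\mathbb{R}\setminus\{0\}$ let $A_n(h)$ be the real constant such that $f(t)=A_n(h)t^n$ for all $t\in h\mathbb{Q}$. Set $\alpha=\sup_{h\in\mathbb{R}^*}A_n(h)$ and $\beta=\inf_{h\in\mathbb{R}^*}A_n(h)$ (values in $[-\infty,+\infty]$). Then: (a) If $\alpha=+\infty$ and $\beta=-\infty$, then $\Gamma=\mathbb{R}^2$. (b) If $\alpha=+\infty$ and $\beta\in\mathbb{R}$, then $\Gamma=\{(x,y):y\geq\beta x^n\}$ if $n$ is even, and $\Gamma=\{(x,y):x\leq 0\text{ and }y\leq\beta x^n\}\cup\{(x,y):x\geq 0\text{ and }y\geq\beta x^n\}$ if $n$ is odd. In particular, if $\beta=0$, then $\Gamma$ is the half space $\{(x,y):y\geq 0\}$ for $n$ even and the union of the first and third quadrants $\{(x,y):xy\geq 0\}$ for $n$ odd. (c) If $\alpha\in\mathbb{R}$ and $\beta=-\infty$, then $\Gamma=\{(x,y):y\leq\alpha x^n\}$ if $n$ is even, and $\Gamma=\{(x,y):x\leq 0\text{ and }y\geq\alpha x^n\}\cup\{(x,y):x\geq 0\text{ and }y\leq\alpha x^n\}$ if $n$ is odd. In particular, if $\alpha=0$, then $\Gamma$ is the half space $\{(x,y):y\leq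 0\}$ for $n$ even and the union of the second and fourth quadrants $\{(x,y):xy\leq 0\}$ for $n$ odd. Furthermore, for every $n\geq 2$ there are examples of discontinuous $n$-monomials $f:\mathbb{R}\to\mathbb{R}$ realizing each one of the cases (a), (b), (c).
   Context: For $f:\mathbb{R}\to\mathbb{R}$ and $h\in\mathbb{R}$, define $\Delta_h^1f(x)=f(x+h)-f(x)$ and $\Delta_h^{k+1}f(x)=\Delta_h^1(\Delta_h^kf)(x)$ for $k\ge 1$. A function $f:\mathbb{R}\to\mathbb{R}$ is an $n$-monomial if $\frac{1}{n!}\Delta_h^nf(x)=f(h)$ for all $x,h\in\mathbb{R}$. For every $n$-monomial $f$ and every $h\neq 0$ there is a unique real number $A_n(h)$ with $f(t)=A_n(h)t^n$ for all $t\in h\mathbb{Q}=\{hr:r\in\mathbb{Q}\}$; equivalently $A_n(h)=f(h)/h^n$. *)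

(* Defs.v *)
From mathcomp Require Import all_boot all_order all_algebra.
From mathcomp Require Import all_classical all_reals all_analysis.
Import Order.TTheory GRing.Theory Num.Theory.
Import numFieldNormedType.Exports.

Set Implicit Arguments.
Unset Strict Implicit.
Unset Printing Implicit Defensive.

Local Open Scope classical_set_scope.
Local Open Scope ring_scope.

Section Monomials.
Variable R : realType.
Implicit Types (n : nat) (f : R -> R) (h : R).

Definition fdelta h f : R -> R := fun x => f (x + h) - f x.

Definition fdelta_iter n h f : R -> R := iter n (fdelta h) f.

Definition is_monomial n f : Prop :=
  forall x h : R, (n`!%:R)^-1 * fdelta_iter n h f x = f h.

Definition graph f : set (R * R) := [set (x, f x) | x in [set: R]].

Definition rat_multiples h : set R := [set h * ratr r | r in [set: rat]].

(* For an n-monomial f and h != 0 exactly one real satisfies the description;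
   [get] returns an arbitrary default when there is none. *)
Definition mon_coef n f h : R :=
  get [set a : R | forall t, rat_multiples h t -> f t = a * t ^+ n].

Definition mon_coefs n f : set (\bar R) :=
  [set (mon_coef n f h)%:E | h in [set h : R | h != 0]].

Definition mon_sup n f : \bar R := ereal_sup (mon_coefs n f).

Definition mon_inf n f : \bar R := ereal_inf (mon_coefs n f).

End Monomials.

(* Main.v *)
Require Import Defs.
From mathcomp Require Import all_boot all_order all_algebra.
From mathcomp Require Import all_classical all_reals all_analysis.
From mathcomp Require Import ring lra.
Import Order.TTheory GRing.Theory Num.Theory.
Import numFieldNormedType.Exports.

Local Open Scope classical_set_scope.
Local Open Scope ring_scope.

(** An n-monomial f satisfies the Frechet equation: all its differences of
order n + 1 vanish.  A function with this property coincides with a polynomial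
on each progression x + Z h, because it is determined there by n + 1
consecutive values ([fdelta_iter_eq0_int]) and can therefore be interpolated;
refining the progression gives a polynomial on x + Q h
([fdelta_iter0_poly_rat]).  The n-th difference of a polynomial of degree at
most n only sees its leading coefficient, which turns the monomial equation
into f (r h) = r ^ n f h for rational r, so the constant attached to h is
f h / h ^ n ([monomial_homog], [mon_coefE]).

For the closure, interpolating once more in a second direction shows that
(r, s) |-> f (r h + s k) is the restriction to Q x Q of a continuous function F
on the real plane ([monomial_plane]).  By density of Q x Q, the closure of the
graph contains the points (p h + q k, F (p, q)) for all real p and q.  Fix
x > 0 and choose h and k whose constants A_h < A < A_k enclose a given A.  On
the real line p h + q k = x the function F takes the value A_h x ^ n on one
axis and A_k x ^ n on the other, so the intermediate value theorem yields a
point where it equals A x ^ n: the closure contains (x, A x ^ n)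
([graph_closure_between]).  Letting x and A vary, taking limits for the boundary
points, and using the symmetry (x, y) |-> (- x, (-1) ^ n y) of the graph, the
closure contains the whole region of cases (a) and (b); in case (b) the region
is closed and contains the graph, whence equality.  Case (c) is case (b) for - f.

For the examples, Zorn's lemma provides an additive a : R -> R equal to 1 on
the translates pi + r with r rational ([exists_discontinuous_additive]).  Since
such a translate can be a small number of either sign, a h / h is unbounded in
both directions.  The function a x * x ^ (n - 1) has constants a h / h and
realizes (a), the function (a x) ^ 2 * x ^ (n - 2) has constants (a h / h) ^ 2
and realizes (b), and its opposite realizes (c).  An infinite supremum forces
discontinuity, because a continuous monomial is c x ^ n, with a single
constant. *)

(** * Finite differences and polynomials *)

Section FiniteDifferences.
Context {R : realType}.
Implicit Types (f g : R -> R) (P Q : {poly R}) (n m : nat).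

Lemma fdelta_iterS n h f x :
  fdelta_iter n.+1 h f x = fdelta_iter n h f (x + h) - fdelta_iter n h f x.
Proof. by []. Qed.

Lemma fdelta_iterSr n h f x :
  fdelta_iter n.+1 h f x = fdelta_iter n h (fdelta h f) x.
Proof. by rewrite /fdelta_iter iterSr. Qed.

(** Differences only involve values on one progression, so they may be computed
in the affine coordinate u |-> x + u h, where the step is a plain number. *)
Lemma fdelta_iter_affine n f x h s t :
  fdelta_iter n (s * h) f (x + t * h) =
  fdelta_iter n s (fun u => f (x + u * h)) t.
Proof.
elim: n t => [//|n IH] t.
by rewrite !fdelta_iterS -!IH mulrDl addrA.
Qed.

Lemma fdelta_iterB n h f g x :
  fdelta_iter n h (fun t => f t - g t) x =
  fdelta_iter n h f x - fdelta_iter n h g x.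
Proof. by elim: n x => [//|n IH] x; rewrite !fdelta_iterS !IH; ring. Qed.

Lemma fdelta_iterN n h f x :
  fdelta_iter n h (fun t => - f t) x = - fdelta_iter n h f x.
Proof. by elim: n x => [//|n IH] x; rewrite !fdelta_iterS !IH; ring. Qed.

Lemma eq_fdelta_iter n h f g x :
  (forall i : nat, f (x + i%:R * h) = g (x + i%:R * h)) ->
  fdelta_iter n h f x = fdelta_iter n h g x.
Proof.
elim: n x => [|n IH] x fg; first by have := fg 0; rewrite mul0r addr0.
rewrite !fdelta_iterS !IH// => i.
by have := fg i.+1; rewrite -natr1 mulrDl mul1r [_ + h]addrC addrA.
Qed.

(** Taylor expansion shows that one difference lowers the degree by one and
multiplies the coefficient of degree n + 1 by (n + 1) h.  The size hypothesis
allows a vanishing leading coefficient, so that for n = deg P + 1 this also says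
that the difference is zero. *)
Lemma fdelta_iter_horner n h P x : (size P <= n.+1)%N ->
  fdelta_iter n h (horner P) x = n`!%:R * h ^+ n * P`_n.
Proof.
elim: n P x => [|n IH] P x sP.
  by rewrite (size1_polyC sP) /= hornerC coefC eqxx fact0 expr0 !mul1r.
pose Q : {poly R} := \sum_(i < n.+1) h ^+ i.+1 *: P^`N(i.+1).
have PQ : fdelta h (horner P) = horner Q.
  apply/funext => y; rewrite /fdelta.
  rewrite (nderiv_taylor_wide _ sP); last exact: mulrC.
  rewrite big_ord_recl expr0 mulr1 nderivn0 addrC addKr horner_sum.
  by apply: eq_bigr => i _; rewrite hornerZ mulrC.
have sQ : (size Q <= n.+1)%N.
  apply/leq_sizeP => j lnj; rewrite coef_sum big1// => i _.
  rewrite coefZ coef_nderivn nth_default ?mul0rn ?mulr0//.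
  by rewrite (leq_trans sP)// addSn ltnS (leq_trans lnj) ?leq_addl.
rewrite fdelta_iterSr PQ IH// coef_sum big_ord_recl big1 ?addr0 => [|i _].
  rewrite coefZ coef_nderivn add1n bin1 factS natrM -[P`_n.+1 *+ _]mulr_natl.
  by rewrite !exprS expr0; ring.
rewrite coefZ coef_nderivn nth_default ?mul0rn ?mulr0//.
by rewrite (leq_trans sP)// !addSn !ltnS leq_addl.
Qed.

(** The vanishing of the n-th difference is a linear recurrence of order n, which
can be run in both directions.  By induction on n: the first difference of g
satisfies the same hypotheses with n - 1, hence vanishes on the progression, on
which g is therefore constant. *)
Lemma fdelta_iter_eq0_int n h g x :
  (forall y, fdelta_iter n h g y = 0) ->
  (forall i : nat, (i < n)%N -> g (x + i%:R * h) = 0) ->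
  forall m : int, g (x + m%:~R * h) = 0.
Proof.
elim: n g => [|n IH] g D0 g0 m; first exact: D0.
have {}IH : forall k : int, g (x + (k + 1)%:~R * h) = g (x + k%:~R * h).
  move=> k; apply/eqP; rewrite -subr_eq0; apply/eqP.
  rewrite intrD mulrDl mul1r addrA.
  apply: (IH (fdelta h g)) => [y|i ilt]; first by rewrite -fdelta_iterSr.
  have := g0 i.+1 ilt; rewrite -natr1 mulrDl mul1r addrA /fdelta => ->.
  by rewrite (g0 i) ?subr0// ltnW.
elim/int_rect: m => [|k IHk|k IHk]; first exact: (g0 0).
  by rewrite -addn1 PoszD IH.
by rewrite -IH -addn1 PoszD opprD addrNK.
Qed.

(** A nonzero polynomial has fewer roots than its size. *)
Lemma poly_eq_on_nat P Q : (forall m, P.[m%:R] = Q.[m%:R]) -> P = Q.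
Proof.
move=> PQ; apply/eqP; rewrite -subr_eq0; apply/eqP.
apply: (@roots_geq_poly_eq0 _ _ [seq i%:R | i <- iota 0 (size (P - Q))]).
- by apply/allP => _ /mapP[i _ ->]; rewrite /root !hornerE PQ subrr.
- by rewrite map_inj_uniq ?iota_uniq//; apply: mulrIn; rewrite oner_eq0.
- by rewrite size_map size_iota.
Qed.

(** The Lagrange interpolation of g at the first n + 1 points of the progression
has the same vanishing differences, hence agrees with g on all of it. *)
Lemma fdelta_iter0_poly_int n h g x :
  (forall y, fdelta_iter n.+1 h g y = 0) ->
  exists2 P : {poly R}, (size P <= n.+1)%N &
    forall m : int, g (x + m%:~R * h) = P.[m%:~R].
Proof.
move=> D0; pose L := (@lagrange R n.+1 (fun i => i%:R)).
pose P : {poly R} := \sum_(i < n.+1) g (x + i%:R * h) *: (tnth L i : {poly R}).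
have inj : injective (fun i : nat => i%:R : R) by apply: mulrIn; rewrite oner_eq0.
have sP : (size P <= n.+1)%N.
  rewrite (leq_trans (size_sum _ _ _))//; apply/bigmax_leqP => i _.
  by rewrite (leq_trans (size_scale_leq _ _))// size_lagrange_.
have PE (i : 'I_n.+1) : P.[i%:R] = g (x + i%:R * h).
  rewrite horner_sum (bigD1 i)//= big1 ?addr0 => [|j ji].
    by rewrite hornerZ lagrange_sample// eqxx mulr1.
  by rewrite hornerZ lagrange_sample// (negPf ji) mulr0.
exists P => // m; apply/eqP; rewrite -subr_eq0; apply/eqP.
have := @fdelta_iter_eq0_int n.+1 1 (fun t => g (x + t * h) - P.[t]) 0.
move=> /(_ _ _ m); rewrite mulr1 add0r; apply.
  move=> y; rewrite fdelta_iterB fdelta_iter_horner ?(leq_trans sP)//.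
  by rewrite [P`__]nth_default// mulr0 subr0 -fdelta_iter_affine mul1r.
by move=> i ilt; rewrite mulr1 add0r (PE (Ordinal ilt)) subrr.
Qed.

(** The progressions of steps h and h / d give two polynomials that agree, up to
the dilation by d, at infinitely many points; so one polynomial serves all
denominators. *)
Lemma fdelta_iter0_poly_rat n g :
  (forall h y, fdelta_iter n.+1 h g y = 0) -> forall x h,
  exists2 P : {poly R}, (size P <= n.+1)%N &
    forall r : rat, g (x + ratr r * h) = P.[ratr r].
Proof.
move=> D0 x h; have [P sP PE] := fdelta_iter0_poly_int n h g x (D0 h).
exists P => // r.
have [a d ad] := ratP r.
have d0 : d.+1%:R != 0 :> R by rewrite pnatr_eq0.
have [Q sQ QE] := fdelta_iter0_poly_int n (d.+1%:R^-1 * h) g x (D0 _).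
have PQ : P = Q \Po (d.+1%:R *: 'X).
  apply: poly_eq_on_nat => m.
  have := QE (m * d.+1)%N; have := PE m; rewrite -!pmulrn => <- QEm.
  rewrite horner_comp hornerZ hornerX [_.+1%:R * _]mulrC -natrM -QEm.
  by congr (g (x + _)); rewrite natrM; field.
rewrite fmorph_div/= !ratr_int PQ horner_comp hornerZ hornerX.
have -> : d.+1%:R * (a%:~R / d.+1%:~R) = a%:~R :> R by rewrite -pmulrn; field.
by rewrite -QE -pmulrn; congr (g (x + _)); field.
Qed.
End FiniteDifferences.

(** * Monomials along rational lines and planes *)

Section Monomials.
Context {R : realType}.
Implicit Types (f g : R -> R) (P Q : {poly R}) (n m : nat).

Lemma monomialE n f x h : is_monomial n f -> fdelta_iter n h f x = n`!%:R * f h.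
Proof.
by move=> /(_ x h) <-; rewrite mulVKf// pnatr_eq0 -lt0n fact_gt0.
Qed.

Lemma monomial_fdelta0 n f x h : is_monomial n f -> fdelta_iter n.+1 h f x = 0.
Proof. by move=> fm; rewrite fdelta_iterS !monomialE// subrr. Qed.

(** A converse used to recognize monomials: the n-th difference extracts the
coefficient of degree n of the polynomial along each progression. *)
Lemma monomial_of_poly n f :
  (forall x h, exists P : {poly R}, [/\ (size P <= n.+1)%N, P`_n = f h &
    forall i : nat, f (x + i%:R * h) = P.[i%:R]]) -> is_monomial n f.
Proof.
move=> Pf x h; have [P [sP Pn PE]] := Pf x h.
have := fdelta_iter_affine n f x h 1 0; rewrite mul1r mul0r addr0 => ->.
rewrite (@eq_fdelta_iter _ _ _ _ (horner P)); last first.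
  by move=> i; rewrite mulr1 add0r.
rewrite fdelta_iter_horner// expr1n mulr1 Pn mulKf//.
Qed.

Lemma monomialN n f : is_monomial n f -> is_monomial n (fun x => - f x).
Proof. by move=> fm x h; rewrite fdelta_iterN mulrN fm. Qed.

(** With P the polynomial of r |-> f (r h), the monomial equation at step r h
reads f (r h) = r ^ n P`_n, and r = 1 identifies P`_n. *)
Lemma monomial_homog n f h (r : rat) :
  is_monomial n f -> f (ratr r * h) = ratr r ^+ n * f h.
Proof.
move=> fm; have [|P sP PE] := fdelta_iter0_poly_rat n f _ 0 h.
  by move=> *; exact: monomial_fdelta0.
have E s : f (ratr s * h) = ratr s ^+ n * P`_n.
  have := monomialE n f 0 (ratr s * h) fm.
  have := fdelta_iter_affine n f 0 h (ratr s) 0; rewrite mul0r addr0 => ->.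
  rewrite (@eq_fdelta_iter _ _ _ _ (horner P)); last first.
    by move=> i; rewrite !add0r -[i%:R](ratr_nat R) -rmorphM -PE add0r.
  have n0 : n`!%:R != 0 :> R by rewrite pnatr_eq0 -lt0n fact_gt0.
  by rewrite fdelta_iter_horner// -mulrA => /(mulfI n0).
by rewrite E; have := E 1; rewrite rmorph1 expr1n !mul1r => ->.
Qed.

Lemma monomial_rat n f (r : rat) :
  is_monomial n f -> f (ratr r) = f 1 * ratr r ^+ n.
Proof. by move=> /(monomial_homog n f 1 r); rewrite mulr1 mulrC. Qed.

Lemma monomial_opp n f x : is_monomial n f -> f (- x) = (-1) ^+ n * f x.
Proof.
by move=> /(monomial_homog n f x (-1)); rewrite rmorphN1 mulN1r.
Qed.

Lemma mon_coefE n f h : is_monomial n f -> h != 0 -> mon_coef n f h = f h / h ^+ n.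
Proof.
move=> fm h0; have hn0 : h ^+ n != 0 by rewrite expf_neq0.
have : f h = mon_coef n f h * h ^+ n.
  apply: (@getPex _ [set a : R | forall t, rat_multiples h t -> f t = a * t ^+ n]).
    exists (f h / h ^+ n) => _ [r _ <-].
    rewrite [h * _]mulrC (monomial_homog n f h r fm) [(_ * h) ^+ n]exprMn.
    by rewrite mulrCA divfK.
  by exists 1 => //; rewrite rmorph1 mulr1.
by move=> ->; rewrite mulfK.
Qed.

Lemma mon_coefs_opp n f : is_monomial n f ->
  mon_coefs n (fun x => - f x) = -%E @` mon_coefs n f.
Proof.
move=> fm; rewrite /mon_coefs image_comp; apply: eq_imagel => h /= h0.
by rewrite !mon_coefE//; [rewrite mulNr|exact: monomialN].
Qed.

Lemma mon_supN n f : is_monomial n f ->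
  mon_sup n (fun x => - f x) = (- mon_inf n f)%E.
Proof. by move=> fm; rewrite /mon_sup mon_coefs_opp// ereal_supN. Qed.

Lemma mon_infN n f : is_monomial n f ->
  mon_inf n (fun x => - f x) = (- mon_sup n f)%E.
Proof. by move=> fm; rewrite /mon_inf mon_coefs_opp// ereal_infN. Qed.

Lemma closure_image (T U : topologicalType) (F : T -> U) (S : set T)
    (S' : set U) p :
  continuous F -> F @` S `<=` S' -> closure S p -> closure S' (F p).
Proof.
move=> cF FSS' Sp B /cF /Sp[q [Sq Bq]].
by exists (F q); split => //; apply: FSS'; exists q.
Qed.

Lemma closure_dense (T : topologicalType) (D : set T) p : dense D -> closure D p.
Proof.
move=> dD B; rewrite nbhsE => -[V [oV Vp] VB].
have [q [Vq Dq]] := dD V (ex_intro _ p Vp) oV.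
by exists q; split => //; exact: VB.
Qed.

Lemma continuous_pair (T U V : topologicalType) (f : T -> U) (g : T -> V) :
  continuous f -> continuous g -> continuous (fun x => (f x, g x)).
Proof. by move=> cf cg x; exact: (cvg_pair (cf x) (cg x)). Qed.

Lemma dense_rat2 :
  dense [set p : R * R | exists r s : rat, p = (ratr r, ratr s)].
Proof.
move=> V [[x y] Vxy] oV.
have : nbhs (x, y) V by exact: open_nbhs_nbhs.
case=> -[A B] /= [nA nB] ABV.
have ratA (C : set R) (z : R) : nbhs z C -> exists r : rat, C (ratr r).
  rewrite nbhsE => -[U [oU Uz] UC].
  have [t [Ut [r _ rt]]] := dense_rat (ex_intro _ z Uz) oU.
  by exists r; rewrite rt; exact: UC.
have [[r Ar] [s Bs]] := (ratA _ _ nA, ratA _ _ nB).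
by exists (ratr r, ratr s); split; [exact: ABV|exists r, s].
Qed.

(** The difference sends a dense set into the closed set {0}. *)
Lemma eq_continuous_rat f g : continuous f -> continuous g ->
  (forall r : rat, f (ratr r) = g (ratr r)) -> f = g.
Proof.
move=> cf cg fg; apply/funext => x; apply/eqP; rewrite -subr_eq0; apply/eqP.
have c0 : closed [set 0 : R].
  apply: accessible_closed_set1; apply: hausdorff_accessible.
  exact: norm_hausdorff.
suff: closure [set 0 : R] (f x - g x) by rewrite -(closure_id _).1.
apply: (@closure_image R R (fun x => f x - g x) (range ratr)).
- by move=> t; apply: cvgB; [exact: cf|exact: cg].
- by move=> _ [_ [r _ <-] <-] /=; rewrite fg subrr.
- by apply: closure_dense; exact: dense_rat.
Qed.

(** For each of the n + 1 interpolation nodes i, the function r |-> f (r h + i k)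
is a polynomial; Lagrange interpolation in the second variable assembles them
into one polynomial in two variables. *)
Lemma monomial_plane n f h k : is_monomial n f ->
  exists2 F : R * R -> R, continuous F &
    forall r s : rat, f (ratr r * h + ratr s * k) = F (ratr r, ratr s).
Proof.
move=> fm.
have fP := fdelta_iter0_poly_rat n f (fun h x => monomial_fdelta0 n f x h fm).
have /choice[P PE] (i : nat) : exists P : {poly R},
    forall r : rat, f (i%:R * k + ratr r * h) = P.[ratr r].
  by have [P _ ?] := fP (i%:R * k) h; exists P.
pose L := (@lagrange R n.+1 (fun i => i%:R)).
exists (fun p => \sum_(i < n.+1) (P i).[p.1] * (tnth L i : {poly R}).[p.2]).
  move=> p; apply: cvg_big => [|i _]; first exact: add_continuous.
  apply: cvgM; apply: continuous_comp; do ?exact: continuous_horner.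
    exact: cvg_fst.
  exact: cvg_snd.
move=> r s; have [Q sQ QE] := fP (ratr r * h) k.
rewrite QE [Q](@lagrange_gen _ n.+1 (fun i => i%:R : R) _ _ Q)//; last first.
  by apply: mulrIn; rewrite oner_eq0.
rewrite horner_sum; apply: eq_bigr => i _; rewrite hornerM hornerC.
by congr (_ * _); rewrite -(ratr_nat R i) -QE -PE addrC ratr_nat.
Qed.
End Monomials.

(** * Points in the closure of the graph *)

Section Closure.
Context {R : realType}.
Implicit Types (f g : R -> R) (n m : nat) (x y b : R).

Lemma mon_coefsE n f : is_monomial n f ->
  mon_coefs n f = [set (f h / h ^+ n)%:E | h in [set h : R | h != 0]].
Proof. by move=> fm; apply: eq_imagel => h /= h0; rewrite mon_coefE. Qed.

(** The segment from (x / h, 0) to (0, x / k) parametrizes the part of the line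
p h + q k = x between the axes, and F crosses the level y on it. *)
Lemma graph_closure_between n f x y : is_monomial n f -> 0 < x ->
  (mon_inf n f < (y / x ^+ n)%:E)%E -> ((y / x ^+ n)%:E < mon_sup n f)%E ->
  closure (graph f) (x, y).
Proof.
move=> fm x0; have xn0 : 0 < x ^+ n by rewrite exprn_gt0.
rewrite /mon_inf /mon_sup mon_coefsE//.
move=> /ereal_inf_lt[_ [h /= h0 <-] hlt] /ereal_sup_gt[_ [k /= k0 <-] klt].
move: hlt klt; rewrite !lte_fin ltr_pdivlMr// ltr_pdivrMr// => hlt klt.
have [F cF FE] := monomial_plane n f h k fm.
have cX (a : R) : continuous (fun t : R => t ^+ n * a).
  by move=> t; apply: cvgM; [exact: exprn_continuous|exact: cvg_cst].
have cF1 : continuous (fun t : R => F (t, 0)).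
  move=> t; apply: continuous_comp; last exact: cF.
  by apply: continuous_pair => u; [exact: cvg_id|exact: cvg_cst].
have cF2 : continuous (fun t : R => F (0, t)).
  move=> t; apply: continuous_comp; last exact: cF.
  by apply: continuous_pair => u; [exact: cvg_cst|exact: cvg_id].
have Fh : (fun t : R => F (t, 0)) = (fun t => t ^+ n * f h).
  apply: eq_continuous_rat => // r.
  by have := FE r 0; rewrite rmorph0 mul0r addr0 (monomial_homog n f h r fm).
have Fk : (fun t : R => F (0, t)) = (fun t => t ^+ n * f k).
  apply: eq_continuous_rat => // r.
  by have := FE 0 r; rewrite rmorph0 mul0r add0r (monomial_homog n f k r fm).
pose phi (t : R) : R * R := ((1 - t) * (x / h), t * (x / k)).
have cphi : continuous phi.
  apply: continuous_pair => t; apply: cvgM; do ?exact: cvg_cst; last exact: cvg_id.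
  by apply: cvgB; [exact: cvg_cst|exact: cvg_id].
have [||t _ Ft] := @IVT R (F \o phi) 0 1 y ler01.
- apply: continuous_subspaceT => t.
  by apply: continuous_comp; [exact: cphi|exact: cF].
- rewrite /phi /= !subrr !subr0 !mul0r !mul1r.
  rewrite (congr1 (@^~ (x / h)) Fh) (congr1 (@^~ (x / k)) Fk) /=.
  rewrite ge_min le_max; apply/andP; split; apply/orP; [left|right].
    by rewrite (le_trans _ (ltW hlt))// !exprMn exprVn; lra.
  by rewrite (le_trans (ltW klt))// !exprMn exprVn; lra.
(* By construction of phi, the point (x, y) lies on the image of the plane. *)
have <- : ((phi t).1 * h + (phi t).2 * k, F (phi t)) = (x, y).
  by rewrite -Ft; congr pair => /=; field; rewrite h0 k0.
apply: (closure_image _ _ (fun p : R * R => (p.1 * h + p.2 * k, F p)) _ _ _ _ _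
  (closure_dense _ _ (phi t) dense_rat2)).
- apply: continuous_pair => // p; apply: cvgD; apply: cvgM;
    do ?exact: cvg_cst; [exact: cvg_fst|exact: cvg_snd].
- by move=> _ [_ [r [s ->]] <-] /=; rewrite -FE; exists (ratr r * h + ratr s * k).
Qed.

(** The approximating points stay to the right of x, hence have a positive
abscissa when x >= 0; this reaches the boundary points, including x = 0. *)
Lemma closed_approx_right (C : set (R * R)) (x y : R) (g : R -> R) : closed C ->
  continuous g -> g 0 = 0 -> (forall e, 0 < e -> C (x + e, y + g e)) -> C (x, y).
Proof.
move=> cC cg g0 Ce; pose c (e : R) : R * R := (x + e, y + g e).
have cc : continuous c.
  apply: continuous_pair => e; apply: cvgD; do ?exact: cvg_cst; first exact: cvg_id.
  exact: cg.
have -> : (x, y) = c 0 by rewrite /c g0 !addr0.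
apply: (@closed_cvg _ _ (0 : R)^'+ _ c C cC); last first.
  by apply: cvg_at_right_filter; exact: cc.
by near=> e; apply: Ce; near: e; exact: nbhs_right_gt.
Unshelve. all: by end_near. Qed.

(** The approximating curve lies above the graph of t |-> b t ^ n by
y - b x ^ n + e, hence strictly above it even when (x, y) is on this graph. *)
Lemma graph_closure_above n f b x y : is_monomial n f ->
  mon_sup n f = +oo%E -> (mon_inf n f <= b%:E)%E -> 0 <= x -> b * x ^+ n <= y ->
  closure (graph f) (x, y).
Proof.
move=> fm fsup finf x0 bxy.
pose g (e : R) := b * ((x + e) ^+ n - x ^+ n) + e.
apply: (@closed_approx_right _ x y g).
- exact: closed_closure.
- have cX : continuous (fun e : R => (x + e) ^+ n).
    move=> e; apply: (@continuous_comp _ _ _ (fun e => x + e) (fun t => t ^+ n)).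
      by apply: cvgD; [exact: cvg_cst|exact: cvg_id].
    exact: exprn_continuous.
  move=> e; apply: cvgD; last exact: cvg_id.
  by apply: cvgM; [exact: cvg_cst|apply: cvgB; [exact: cX|exact: cvg_cst]].
- by rewrite /g !addr0 subrr mulr0.
move=> e e0; have xe0 : 0 < x + e by rewrite ltr_wpDl.
apply: (@graph_closure_between n) => //; last by rewrite fsup ltry.
apply: (le_lt_trans finf); rewrite lte_fin ltr_pdivlMr ?exprn_gt0// /g.
lra.
Qed.

Lemma graph_closure_everywhere n f x y : is_monomial n f ->
  mon_sup n f = +oo%E -> mon_inf n f = -oo%E -> 0 <= x -> closure (graph f) (x, y).
Proof.
move=> fm fsup finf x0; apply: (@closed_approx_right _ x y (fun=> 0)) => //.
- exact: closed_closure.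
- by move=> ?; exact: cvg_cst.
move=> e e0; have xe0 : 0 < x + e by rewrite ltr_wpDl.
by apply: (@graph_closure_between n) => //; rewrite ?fsup ?finf ?ltry ?ltNyr.
Qed.

(** Homogeneity for the factor -1 reduces every statement to x >= 0. *)
Lemma graph_closure_sym n f x y : is_monomial n f ->
  closure (graph f) (x, y) -> closure (graph f) (- x, (-1) ^+ n * y).
Proof.
move=> fm.
apply: (closure_image _ _ (fun p : R * R => (- p.1, (-1) ^+ n * p.2))).
- apply: continuous_pair => p; first by apply: cvgN; exact: cvg_fst.
  by apply: cvgM; [exact: cvg_cst|exact: cvg_snd].
- by move=> _ [_ [t _ <-] <-] /=; exists (- t); rewrite ?(monomial_opp n).
Qed.

Lemma graph_closureN f x y :
  closure (graph f) (x, y) -> closure (graph (fun t => - f t)) (x, - y).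
Proof.
apply: (closure_image _ _ (fun p : R * R => (p.1, - p.2))).
- by apply: continuous_pair => p; [exact: cvg_fst|apply: cvgN; exact: cvg_snd].
- by move=> _ [_ [t _ <-] <-] /=; exists t.
Qed.

Lemma monomial_ge n f b x : (0 < n)%N -> is_monomial n f ->
  mon_inf n f = b%:E -> 0 <= x -> b * x ^+ n <= f x.
Proof.
move=> n0 fm finf; rewrite le_eqVlt => /predU1P[<-|x0].
  have := monomial_homog n f 1 0 fm; rewrite rmorph0 mul0r => ->.
  by rewrite expr0n gtn_eqF// mulr0 mul0r.
have : (mon_inf n f <= (f x / x ^+ n)%:E)%E.
  by apply: ereal_inf_lbound; rewrite mon_coefsE//; exists x; rewrite //= gt_eqF.
by rewrite finf lee_fin ler_pdivlMr// exprn_gt0.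
Qed.

End Closure.

(** * The shape of the closure *)

Section ClosureShape.
Context {R : realType}.
Implicit Types (f g : R -> R) (n m : nat) (x y a b : R).

Lemma signr_even n : ~~ odd n -> (-1) ^+ n = 1 :> R.
Proof. by rewrite -signr_odd => /negPf ->. Qed.

Lemma signr_of_odd n : odd n -> (-1) ^+ n = -1 :> R.
Proof. by rewrite -signr_odd => ->. Qed.

Lemma closed_le_fun (T : topologicalType) (u v : T -> R) :
  continuous u -> continuous v -> closed [set p | u p <= v p].
Proof.
move=> cu cv.
have -> : [set p | u p <= v p] = (fun p => v p - u p) @^-1` [set t | 0 <= t].
  by apply/funext => p /=; rewrite subr_ge0.
apply: preimage_closed; last exact: closed_ge.
by move=> p _; apply: cvgB; [exact: cv|exact: cu].
Qed.

Lemma continuous_scaled_power b n : continuous (fun p : R * R => b * p.1 ^+ n).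
Proof.
move=> p; apply: cvgM; first exact: cvg_cst.
have cX : continuous (fun p : R * R => p.1 ^+ n).
  move=> q; apply: (@continuous_comp (R * R)%type R R fst (fun t => t ^+ n)).
    exact: cvg_fst.
  exact: exprn_continuous.
exact: cX.
Qed.

Lemma closure_full n f : is_monomial n f ->
  mon_sup n f = +oo%E -> mon_inf n f = -oo%E -> closure (graph f) = [set: R * R].
Proof.
move=> fm fsup finf; apply/seteqP; split=> // -[x y] _.
have [x0|/ltW x0] := leP 0 x; first exact: (graph_closure_everywhere n).
rewrite -[x]opprK -[y](signrMK n); apply: (graph_closure_sym n) => //.
by apply: (graph_closure_everywhere n); rewrite ?oppr_ge0.
Qed.

Lemma closure_even n f b : (0 < n)%N -> is_monomial n f -> ~~ odd n ->
  mon_sup n f = +oo%E -> mon_inf n f = b%:E ->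
  closure (graph f) = [set p : R * R | p.2 >= b * p.1 ^+ n].
Proof.
move=> n0 fm ev fsup finf; have s1 := signr_even n ev.
apply/seteqP; split=> [|[x y] /= bxy].
  set C := (X in _ `<=` X).
  have cC : closed C.
    apply: closed_le_fun; first exact: continuous_scaled_power.
    by move=> p; exact: cvg_snd.
  rewrite (closure_id C).1//; apply: closureS => _ [x _ <-]; rewrite /C/=.
  have [x0|/ltW x0] := leP 0 x; first exact: monomial_ge.
  have : b * (- x) ^+ n <= f (- x) by apply: monomial_ge; rewrite ?oppr_ge0.
  by rewrite exprNn (monomial_opp n)// s1 !mul1r.
have [x0|/ltW x0] := leP 0 x.
  by apply: (graph_closure_above n _ b) => //; rewrite finf.
rewrite -[x]opprK -[y](signrMK n); apply: (graph_closure_sym n) => //.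
apply: (graph_closure_above n _ b) => //; rewrite ?finf ?oppr_ge0//.
by rewrite [(- x) ^+ n]exprNn s1 !mul1r.
Qed.

Lemma closure_odd n f b : is_monomial n f -> odd n ->
  mon_sup n f = +oo%E -> mon_inf n f = b%:E ->
  closure (graph f) = [set p : R * R | p.1 <= 0 /\ p.2 <= b * p.1 ^+ n] `|`
                      [set p : R * R | p.1 >= 0 /\ p.2 >= b * p.1 ^+ n].
Proof.
move=> fm od fsup finf; have s1 := signr_of_odd n od.
have n0 : (0 < n)%N by case: (n) od.
have c1 : continuous (fst : R * R -> R) by move=> p; exact: cvg_fst.
have c2 : continuous (snd : R * R -> R) by move=> p; exact: cvg_snd.
have c0 : continuous (fun p : R * R => 0 : R) by move=> p; exact: cvg_cst.
have cb := continuous_scaled_power b n.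
apply/seteqP; split=> [|[x y] /= bxy].
  set C := (X in _ `<=` X).
  have cC : closed C by apply: closedU; apply: closedI; apply: closed_le_fun.
  rewrite (closure_id C).1//; apply: closureS => _ [x _ <-]; rewrite /C/=.
  have [x0|/ltW x0] := leP 0 x; [right|left]; split=> //; first exact: monomial_ge.
  have : b * (- x) ^+ n <= f (- x) by apply: monomial_ge; rewrite ?oppr_ge0.
  by rewrite exprNn (monomial_opp n)// s1 !mulN1r mulrN lerN2.
case: bxy => -[x0 bxy]; last first.
  by apply: (graph_closure_above n _ b) => //; rewrite finf.
rewrite -[x]opprK -[y](signrMK n); apply: (graph_closure_sym n) => //.
apply: (graph_closure_above n _ b) => //; rewrite ?finf ?oppr_ge0//.
by rewrite [(- x) ^+ n]exprNn s1 !mulN1r mulrN lerN2.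
Qed.

Lemma graph_closure_opp f :
  closure (graph f) = [set p | closure (graph (fun t => - f t)) (p.1, - p.2)].
Proof.
apply/seteqP; split=> -[x y] /=; first exact: graph_closureN.
move=> /graph_closureN; rewrite opprK.
by congr (closure (graph _) _); apply/funext => t; rewrite opprK.
Qed.

Lemma first_third_quadrantsE : [set p : R * R | p.1 <= 0 /\ p.2 <= 0] `|`
  [set p : R * R | p.1 >= 0 /\ p.2 >= 0] = [set p : R * R | p.1 * p.2 >= 0].
Proof.
apply/seteqP; split=> -[x y] /=.
  by move=> [[? ?]|[? ?]]; [exact: mulr_le0|exact: mulr_ge0].
have [x0|x0|->] := ltgtP x 0.
- by rewrite nmulr_rge0// => y0; left; split=> //; exact: ltW.
- by rewrite pmulr_rge0// => y0; right; split=> //; exact: ltW.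
- by move=> _; have [y0|/ltW y0] := leP y 0; [left|right].
Qed.

Lemma closure_shape_above n f b : (0 < n)%N -> is_monomial n f ->
  mon_sup n f = +oo%E -> mon_inf n f = b%:E ->
  [/\ ~~ odd n -> closure (graph f) = [set p : R * R | p.2 >= b * p.1 ^+ n],
      odd n -> closure (graph f) =
        [set p : R * R | p.1 <= 0 /\ p.2 <= b * p.1 ^+ n] `|`
        [set p : R * R | p.1 >= 0 /\ p.2 >= b * p.1 ^+ n],
      b = 0 -> ~~ odd n -> closure (graph f) = [set p : R * R | p.2 >= 0]
    & b = 0 -> odd n -> closure (graph f) = [set p : R * R | p.1 * p.2 >= 0]].
Proof.
move=> n0 fm fsup finf.
have ev od := closure_even n f b n0 fm od fsup finf.
have od' od := closure_odd n f b fm od fsup finf.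
split=> // b0.
  by move=> /ev ->; apply/funext => p /=; rewrite b0 mul0r.
move=> /od' ->; rewrite -first_third_quadrantsE.
by congr (_ `|` _); apply/funext => p /=; rewrite b0 mul0r.
Qed.

Lemma closure_shape_below n f a : (0 < n)%N -> is_monomial n f ->
  mon_sup n f = a%:E -> mon_inf n f = -oo%E ->
  [/\ ~~ odd n -> closure (graph f) = [set p : R * R | p.2 <= a * p.1 ^+ n],
      odd n -> closure (graph f) =
        [set p : R * R | p.1 <= 0 /\ p.2 >= a * p.1 ^+ n] `|`
        [set p : R * R | p.1 >= 0 /\ p.2 <= a * p.1 ^+ n],
      a = 0 -> ~~ odd n -> closure (graph f) = [set p : R * R | p.2 <= 0]
    & a = 0 -> odd n -> closure (graph f) = [set p : R * R | p.1 * p.2 <= 0]].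
Proof.
move=> n0 fm fsup finf.
have := @closure_shape_above n (fun t => - f t) (- a) n0 (monomialN n f fm).
rewrite mon_supN// mon_infN// fsup finf => /(_ erefl erefl)[ev od ev0 od0].
rewrite (graph_closure_opp f).
split=> [/ev|/od|a0 /ev0|a0 /od0] E; rewrite E ?a0 ?oppr0//; apply/funext => p /=.
- by rewrite mulNr lerN2.
- by rewrite /setU/= !mulNr !lerN2.
- by rewrite oppr_ge0.
- by rewrite mulrN oppr_ge0.
Qed.
End ClosureShape.

(** * Examples *)

Section Examples.
Context {R : realType}.
Implicit Types (f g : R -> R) (n m : nat) (x y a b : R).

Lemma continuous_monomialE n f : is_monomial n f -> continuous f ->
  f = fun t => f 1 * t ^+ n.
Proof.
move=> fm cf; apply: eq_continuous_rat => // [t|r].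
  by apply: cvgM; [exact: cvg_cst|exact: exprn_continuous].
exact: monomial_rat.
Qed.

(** A continuous monomial has only one constant. *)
Lemma mon_sup_pinfty_discontinuous n f : is_monomial n f ->
  mon_sup n f = +oo%E -> ~ continuous f.
Proof.
move=> fm fsup cf.
have : (mon_sup n f <= (f 1)%:E)%E.
  rewrite /mon_sup mon_coefsE//; apply: ge_ereal_sup => _ [h /= h0 <-].
  rewrite (continuous_monomialE n f fm cf) /= expr1n mulr1 mulfK//.
  by rewrite expf_neq0.
by rewrite fsup leye_eq.
Qed.

(** The two facts are proved together, since the induction on the coefficient
needs the bound on the size. *)
Lemma prod_affine_poly n (c d : 'I_n -> R) :
  let P := \prod_(i < n) (d i *: 'X + (c i)%:P) in
  (size P <= n.+1)%N /\ P`_n = \prod_(i < n) d i.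
Proof.
elim: n c d => [|n IH] c d /=; first by rewrite !big_ord0 size_poly1 coef1.
rewrite !big_ord_recl; set Q := \prod_(i < n) _.
have [sQ Qn] : (size Q <= n.+1)%N /\ Q`_n = \prod_(i < n) d (lift ord0 i).
  exact: IH.
split.
  have sA : (size (d ord0 *: 'X + (c ord0)%:P)%R <= 2)%N.
    rewrite (leq_trans (size_polyD _ _))// geq_max.
    rewrite (leq_trans (size_scale_leq _ _)) ?size_polyX//=.
    by rewrite (leq_trans (size_polyC_leq1 _)).
  rewrite (leq_trans (size_polyMleq _ _))// -subn1 leq_subLR.
  exact: leq_add sA sQ.
rewrite mulrDl -scalerAl coefD coefZ coefXM coefCM /= Qn.
by rewrite [Q`_n.+1]nth_default// mulr0 addr0.
Qed.

(** Along x + t h, each additive factor is the affine polynomial a x + t a h. *)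
Lemma monomial_prod n (a : 'I_n -> R -> R) :
  (forall i x y, a i (x + y) = a i x + a i y) ->
  is_monomial n (fun x => \prod_(i < n) a i x).
Proof.
move=> aD; apply: monomial_of_poly => x h.
have aM i (k : nat) : a i (x + k%:R * h) = a i x + k%:R * a i h.
  elim: k => [|k IH]; first by rewrite !mul0r !addr0.
  by rewrite -natr1 !mulrDl !mul1r !addrA aD IH.
have [sP Pn] := prod_affine_poly n (fun i => a i x) (fun i => a i h).
exists (\prod_(i < n) (a i h *: 'X + (a i x)%:P)); split => // k.
rewrite horner_prod; apply: eq_bigr => i _.
by rewrite hornerD hornerZ hornerX hornerC aM addrC mulrC.
Qed.

(** The set V must miss s + Q, and not only s, instead of containing 1.  The
empty set then qualifies, as the empty chain in Zorn's lemma demands, while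
a maximal V is a rational subspace that contains 1. *)
Definition rat_subspace_avoiding (s : R) (V : set R) : Prop :=
  (forall x y (q : rat), V x -> V y -> V (x + ratr q * y)) /\
  (forall r : rat, ~ V (s + ratr r)).

Lemma rational_add_pi (r : rat) : pi + ratr r <> 0 :> R.
Proof.
move=> /eqP; rewrite addr_eq0 => /eqP E; apply: (@pi_irrationnal R).
by rewrite E -rmorphN; exists (- r).
Qed.

(** A maximal rational subspace V containing 1 and missing pi is a complement of
the line Q pi: if x is outside V, then adjoining x must produce an element of
pi + Q, so that x lies in V + Q pi.  The function sought is the
coordinate along pi; it vanishes on Q. *)
Lemma exists_discontinuous_additive : exists a : R -> R,
  (forall x y, a (x + y) = a x + a y) /\ forall r : rat, a (pi + ratr r) = 1.
Proof.
have [|V [[VD Vpi] Vmax]] := @Zorn_bigcup R (rat_subspace_avoiding pi).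
  move=> F FP Ftot; split=> [x y q [X FX Xx] [Y FY Yy]|r [X FX]]; last first.
    exact: (FP _ FX).2.
  have [XY|YX] := Ftot _ _ FX FY.
    by exists Y => //; apply: (FP _ FY).1 => //; exact: XY.
  by exists X => //; apply: (FP _ FX).1 => //; exact: YX.
have V0 : V 0.
  apply: contrapT => nV0.
  have Ve x : ~ V x.
    move=> Vx; apply: nV0; have := VD x x (-1) Vx Vx.
    by rewrite rmorphN1 mulN1r subrr.
  apply: (Vmax [set 0]); first by split=> [x /Ve//|/(_ _ erefl)].
  split=> [x y q -> ->|r]; first by rewrite /= mulr0 addr0.
  exact: rational_add_pi.
have VZ q x : V x -> V (ratr q * x) by move=> Vx; rewrite -[_ * _]add0r; exact: VD.
(* Otherwise V + Q z would be a larger admissible set. *)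
have adjoin z : V z \/ exists q r : rat, V (pi + ratr r + ratr q * z).
  apply: contrapT => /not_orP[nVz nex].
  pose W : set R := [set t | exists v q, V v /\ t = v + ratr q * z].
  apply: (Vmax W).
    split=> [v Vv|WV]; first by exists v, 0; rewrite rmorph0 mul0r addr0.
    by apply: nVz; apply: WV; exists 0, 1; rewrite rmorph1 mul1r add0r.
  split=> [_ _ q [v [p [Vv ->]]] [w [r [Vw ->]]]|r [v [q [Vv E]]]].
    exists (v + ratr q * w), (p + q * r); split; first exact: VD.
    by rewrite rmorphD rmorphM; ring.
  apply: nex; exists (- q), r.
  by rewrite E rmorphN mulNr addrK.
have V1 : V 1.
  have [//|[q [r]]] := adjoin 1.
  by rewrite mulr1 -addrA -rmorphD => /Vpi.
have Vrat r : V (ratr r) by rewrite -[ratr r]mulr1; exact: VZ.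
have /choice[c cP] x : exists q : rat, V (x - ratr q * pi).
  have [Vx|[q [r Vq]]] := adjoin x; first by exists 0; rewrite rmorph0 mul0r subr0.
  have q0 : q != 0.
    by apply/eqP => q0; move: Vq; rewrite q0 rmorph0 mul0r addr0 => /Vpi.
  have q0' : ratr q != 0 :> R by rewrite fmorph_eq0.
  exists (- q^-1).
  have := VD _ _ (- r) Vq V1; move=> /(VZ q^-1); congr V.
  by rewrite !rmorphN fmorphV; field.
have cU x q : V (x - ratr q * pi) -> c x = q.
  move=> Vq; apply/eqP; rewrite -subr_eq0; apply/negPn/negP => d0.
  have := VD _ _ (-1) Vq (cP x); move=> /(VZ (c x - q)^-1).
  set t := (X in V X); suff -> : t = pi + ratr 0 by move/Vpi.
  have d0' : ratr (c x) - ratr q != 0 :> R by rewrite -rmorphB fmorph_eq0.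
  by rewrite /t rmorph0 rmorphN1 fmorphV rmorphB; field.
exists (fun x => ratr (c x)); split=> [x y|r].
  rewrite -rmorphD; congr ratr; apply: cU.
  have := VD _ _ 1 (cP x) (cP y); congr V; rewrite rmorph1 rmorphD; ring.
rewrite (cU _ 1) ?rmorph1// mul1r addrAC subrr add0r.
exact: Vrat.
Qed.

Lemma monomial_additive_power (a : R -> R) k m :
  (forall x y, a (x + y) = a x + a y) ->
  is_monomial (k + m) (fun x => a x ^+ k * x ^+ m).
Proof.
move=> aD.
have -> : (fun x => a x ^+ k * x ^+ m) = (fun x => \prod_(i < k + m)
    (if (i < k)%N then a else id) x).
  apply/funext => x; rewrite big_split_ord /=.
  rewrite (eq_bigr (fun=> a x)) => [|i _]; last by rewrite ltn_ord.
  rewrite [X in _ = _ * X](eq_bigr (fun=> x)) => [|i _]; last first.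
    by rewrite ltnNge leq_addr.
  by rewrite !prodr_const !card_ord.
by apply: monomial_prod => i x y; case: ifP.
Qed.

(** The constant attached to h by the monomial of [monomial_additive_power]. *)
Lemma additive_power_coef (a : R -> R) k m h : h != 0 ->
  a h ^+ k * h ^+ m / h ^+ (k + m) = (a h / h) ^+ k.
Proof.
move=> h0; have hm0 : h ^+ m != 0 by rewrite expf_neq0.
by rewrite [h ^+ (k + m)]exprD invfM mulrACA divff// mulr1 expr_div_n.
Qed.

(** pi + Q is dense. *)
Lemma small_pi_translate (M : R) : 0 < M ->
  (exists r : rat, 0 < pi + ratr r :> R /\ M < (pi + ratr r)^-1) /\
  (exists r : rat, pi + ratr r < 0 :> R /\ (pi + ratr r)^-1 < - M).
Proof.
move=> M0; have MV0 : 0 < M^-1 by rewrite invr_gt0.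
split.
  have [|r] := @rat_in_itvoo R (- pi) (- pi + M^-1); first by rewrite ltrDl.
  rewrite in_itv /= => /andP[r1 r2]; exists r.
  have h0 : 0 < pi + ratr r :> R by rewrite -ltrBlDl sub0r.
  by split=> //; rewrite -(invrK M) ltf_pV2 ?posrE// -ltrBrDl addrC.
have [|r] := @rat_in_itvoo R (- pi - M^-1) (- pi); first by rewrite ltrBlDr ltrDl.
rewrite in_itv /= => /andP[r1 r2]; exists r.
have h0 : pi + ratr r < 0 :> R by rewrite -ltrBrDl sub0r.
split=> //; rewrite ltrNr -invrN -(invrK M) ltf_pV2 ?posrE ?oppr_gt0//.
by rewrite ltrNl -ltrBlDl addrC.
Qed.

Lemma mon_sup_pinfty n f : is_monomial n f ->
  (forall M, 0 < M -> exists2 h, h != 0 & M < f h / h ^+ n) -> mon_sup n f = +oo%E.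
Proof.
move=> fm fM; apply: eq_infty => r.
have [|h h0 rh] := fM (Num.max r 1); first by rewrite lt_max ltr01 orbT.
have rfh : r <= f h / h ^+ n by rewrite ltW// (le_lt_trans _ rh)// le_max lexx.
apply: (@le_trans _ _ (f h / h ^+ n)%:E); first by rewrite lee_fin.
by rewrite /mon_sup mon_coefsE//; apply: ereal_sup_ubound; exists h.
Qed.

Lemma mon_inf_ninfty n f : is_monomial n f ->
  (forall M, 0 < M -> exists2 h, h != 0 & f h / h ^+ n < - M) -> mon_inf n f = -oo%E.
Proof.
move=> fm fM; apply: oppe_inj; rewrite -mon_supN//.
apply: mon_sup_pinfty; first exact: monomialN.
by move=> M /fM[h h0 hM]; exists h => //; rewrite mulNr ltrNr.
Qed.

Lemma example_unbounded n : (1 <= n)%N -> exists f : R -> R,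
  [/\ is_monomial n f, ~ continuous f, mon_sup n f = +oo%E & mon_inf n f = -oo%E].
Proof.
case: n => // m _; have [a [aD a1]] := exists_discontinuous_additive.
have fm := monomial_additive_power a 1 m aD; rewrite add1n in fm.
have coefE h : h != 0 -> a h = 1 -> a h ^+ 1 * h ^+ m / h ^+ m.+1 = h^-1.
  by move=> h0 ah; rewrite -add1n additive_power_coef// ah div1r.
set f := (fun x => _) in fm; exists f.
have fsup : mon_sup m.+1 f = +oo%E.
  apply: mon_sup_pinfty => // M M0; have [[r [r0 rM]] _] := small_pi_translate M M0.
  exists (pi + ratr r); first by rewrite gt_eqF.
  by rewrite /f coefE ?gt_eqF.
split=> //; first exact: (mon_sup_pinfty_discontinuous m.+1).
apply: mon_inf_ninfty => // M M0; have [_ [r [r0 rM]]] := small_pi_translate M M0.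
exists (pi + ratr r); first by rewrite lt_eqF.
by rewrite /f coefE ?lt_eqF.
Qed.

(** The constants are squares, so their infimum is a finite nonnegative number. *)
Lemma example_bounded_below n : (2 <= n)%N -> exists (f : R -> R) (b : R),
  [/\ is_monomial n f, ~ continuous f, mon_sup n f = +oo%E & mon_inf n f = b%:E].
Proof.
case: n => [|[|m]]// _; have [a [aD a1]] := exists_discontinuous_additive.
have fm := monomial_additive_power a 2 m aD; rewrite !addSn add0n in fm.
set f := (fun x => _) in fm; exists f, (fine (mon_inf m.+2 f)).
have fsup : mon_sup m.+2 f = +oo%E.
  apply: mon_sup_pinfty => // M M0.
  (* M + 1 > 1 ensures that the square of a larger number exceeds M. *)
  have [|[r [r0 rM]] _] := small_pi_translate (M + 1); first by lra.
  exists (pi + ratr r); first by rewrite gt_eqF.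
  rewrite /f -[m.+2]add2n additive_power_coef ?gt_eqF// a1 div1r expr2.
  set u := _^-1 in rM *; nra.
split=> //; first exact: (mon_sup_pinfty_discontinuous m.+2).
have inf_ge0 : (0 <= mon_inf m.+2 f)%E.
  rewrite /mon_inf mon_coefsE//; apply: le_ereal_inf_tmp => _ [h /= h0 <-].
  by rewrite lee_fin /f -[m.+2]add2n additive_power_coef// sqr_ge0.
have inf_le : (mon_inf m.+2 f <= (f 1 / 1 ^+ m.+2)%:E)%E.
  rewrite /mon_inf mon_coefsE//; apply: ereal_inf_lbound.
  by exists 1; rewrite //= oner_neq0.
rewrite fineK// ge0_fin_numE//; exact: le_lt_trans inf_le (ltry _).
Qed.

Lemma example_bounded_above n : (2 <= n)%N -> exists (f : R -> R) (a : R),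
  [/\ is_monomial n f, ~ continuous f, mon_sup n f = a%:E & mon_inf n f = -oo%E].
Proof.
move=> /example_bounded_below[f [b [fm cf fsup finf]]].
exists (fun x => - f x), (- b); split.
- exact: monomialN.
- move=> cNf; apply: cf => x; rewrite -[f]opprK.
  by apply: continuousN; exact: cNf.
- by rewrite mon_supN// finf.
- by rewrite mon_infN// fsup.
Qed.
End Examples.

Theorem theorem2p7 (R : realType) :
  (forall (n : nat) (f : R -> R),
     (1 <= n)%N -> is_monomial n f -> ~ continuous f ->
     [/\ (mon_sup n f = +oo%E -> mon_inf n f = -oo%E ->
            closure (graph f) = [set: R * R]),
         (forall b : R, mon_sup n f = +oo%E -> mon_inf n f = b%:E ->
            [/\ ~~ odd n ->
                  closure (graph f) = [set p : R * R | p.2 >= b * p.1 ^+ n],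
                odd n ->
                  closure (graph f) =
                    [set p : R * R | p.1 <= 0 /\ p.2 <= b * p.1 ^+ n] `|`
                    [set p : R * R | p.1 >= 0 /\ p.2 >= b * p.1 ^+ n],
                b = 0 -> ~~ odd n ->
                  closure (graph f) = [set p : R * R | p.2 >= 0]
              & b = 0 -> odd n ->
                  closure (graph f) = [set p : R * R | p.1 * p.2 >= 0]])
       & (forall a : R, mon_sup n f = a%:E -> mon_inf n f = -oo%E ->
            [/\ ~~ odd n ->
                  closure (graph f) = [set p : R * R | p.2 <= a * p.1 ^+ n],
                odd n ->
                  closure (graph f) =
                    [set p : R * R | p.1 <= 0 /\ p.2 >= a * p.1 ^+ n] `|`
                    [set p : R * R | p.1 >= 0 /\ p.2 <= a * p.1 ^+ n],
                a = 0 -> ~~ odd n ->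
                  closure (graph f) = [set p : R * R | p.2 <= 0]
              & a = 0 -> odd n ->
                  closure (graph f) = [set p : R * R | p.1 * p.2 <= 0]])])
  /\
  (forall n : nat, (2 <= n)%N ->
     [/\ (exists f : R -> R,
            [/\ is_monomial n f, ~ continuous f,
                mon_sup n f = +oo%E & mon_inf n f = -oo%E]),
         (exists (f : R -> R) (b : R),
            [/\ is_monomial n f, ~ continuous f,
                mon_sup n f = +oo%E & mon_inf n f = b%:E])
       & (exists (f : R -> R) (a : R),
            [/\ is_monomial n f, ~ continuous f,
                mon_sup n f = a%:E & mon_inf n f = -oo%E])]).
Proof.
split=> [n f n0 fm _|n n2].
  split=> [fsup finf|b fsup finf|a fsup finf].
  - exact: (closure_full n).
  - exact: closure_shape_above.
  - exact: closure_shape_below.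
split.
- by apply: example_unbounded; exact: ltnW.
- exact: example_bounded_below.
- exact: example_bounded_above.
Qed.
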